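(* Let $a\ge 1$ and $n\ge 2$ be integers. The metallic cube $\Pi^a_n$ admits the decomposition $$\Pi^a_n=\Pi^a_{n-1}\oplus\cdots\oplus\Pi^a_{n-1}\oplus\Pi^a_{n-2},$$ in which the factor $\Pi^a_{n-1}$ is repeated $a$ times. That is, the vertex set of $\Pi^a_n$ can be partitioned into $a+1$ sets such that $a$ of them each induce a subgraph of $\Pi^a_n$ isomorphic to $\Pi^a_{n-1}$, and the remaining one induces a subgraph isomorphic to $\Pi^a_{n-2}$.
   Context: For integers $a\ge 1$ and $n\ge 0$, let $\mathcal{S}^a_n$ be the set of all words $\alpha_1\cdots\alpha_n$ of length $n$ over the alphabet $\{0,1,\dots,a\}$ such that the letter $a$ appears only immediately after a letter $0$ (so $\alpha_1\ne a$, and $\alpha_i=a$ implies $\alpha_{i-1}=0$). The metallic cube $\Pi^a_n$ is the simple graph with vertex set $\mathcal{S}^a_n$ in which two vertices $\alpha,\beta$ are adjacent if and only if $\sum_{k=1}^n|\alpha_k-\beta_k|=1$, i.e. one is obtained from the other by replacing a single letter $k$ by $k+1$, $0\le k\le a-1$. ($\Pi^a_0$ has a single vertex, the empty word.) The notation $G=G_1\oplus\cdots\oplus G_m$ means that $V(G)$ can be partitioned into $m$ sets such that the $i$-th set induces a subgraph of $G$ isomorphic to $G_i$ (edges of $G$ between different parts are allowed). *)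

(* Defs.v *)
From mathcomp Require Import all_boot ssrint.
Set Implicit Arguments.
Unset Strict Implicit.
Unset Printing Implicit Defensive.

Record sgraph := SGraph {
  vertex :> finType;
  adj : rel vertex;
  adj_sym : symmetric adj;
  adj_irrefl : irreflexive adj }.

Definition sgraph_iso (G H : sgraph) : Prop :=
  exists2 f : G -> H, bijective f & {mono f : x y / adj x y}.

Section Induced.
Variables (G : sgraph) (S : {set G}).

Definition induced_adj : rel {x : G | x \in S} :=
  fun x y => adj (val x) (val y).

Lemma induced_adj_sym : symmetric induced_adj.
Proof. by move=> x y; apply: adj_sym. Qed.

Lemma induced_adj_irrefl : irreflexive induced_adj.
Proof. by move=> x; apply: adj_irrefl. Qed.

Definition induced : sgraph := SGraph induced_adj_sym induced_adj_irrefl.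
End Induced.

(* G = Gs_0 (+) ... (+) Gs_(m-1); edges of G between distinct parts are
   unconstrained.  Injectivity of V makes the m indexed parts distinct, hence,
   by [partition], pairwise disjoint. *)
Definition decomposes (G : sgraph) (m : nat) (Gs : 'I_m -> sgraph) : Prop :=
  exists V : 'I_m -> {set G},
    [/\ injective V,
        partition [set V i | i : 'I_m] [set: G]
      & forall i : 'I_m, sgraph_iso (induced (V i)) (Gs i)].

(* The letters are 'I_a.+1, so that ord0 is the letter 0 and ord_max the
   letter a; positions are counted from 0. *)
Definition metallic_word (a n : nat) (w : n.-tuple 'I_a.+1) : bool :=
  [forall i : 'I_n, (tnth w i == ord_max) ==>
     [exists j : 'I_n, (j.+1 == i :> nat) && (tnth w j == ord0)]].

Section MetallicCube.
Variables a n : nat.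

Definition metallic_adj : rel {w : n.-tuple 'I_a.+1 | metallic_word w} :=
  fun u v => \sum_(k < n) `|tnth (val u) k - tnth (val v) k|%N == 1.

Lemma metallic_adj_sym : symmetric metallic_adj.
Proof.
by move=> u v; congr (_ == _); apply: eq_bigr => k _; rewrite distnC.
Qed.

Lemma metallic_adj_irrefl : irreflexive metallic_adj.
Proof. by move=> u; rewrite /metallic_adj big1 // => k _; rewrite distnn. Qed.

Definition metallic_cube : sgraph :=
  SGraph metallic_adj_sym metallic_adj_irrefl.
End MetallicCube.

(* Main.v *)
Require Import Defs.
From mathcomp Require Import all_boot ssrint.

Set Implicit Arguments.
Unset Strict Implicit.
Unset Printing Implicit Defensive.

(** Sort the words by their first letter, except that the words starting with
    [0 a] are set apart.  The first letter of a word is never [a], so this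
    gives [a] classes indexed by the first letter [i < a], and one more class.

    Within a class all words share a prefix [p] ([i], respectively [0 a]), so
    that the distance between two of them is the distance between what follows
    the prefix, and deleting the prefix is a graph isomorphism onto its image
    ([induced_prefix_iso]).  It remains to see that the image is a whole
    metallic cube.  What follows the prefix never starts with [a]: after [0]
    because the words [0 a] were set apart, after any other letter because
    [a] may only follow [0] (for the prefix [0 a] this uses [a <> 0]).  So
    what remains is itself an admissible word, and conversely any admissible
    word may be put after the prefix.

    The constraint on words relates consecutive letters only; with [a <> 0] it
    says that the word is a path for this relation starting from a virtual
    letter [a] in front of it ([metallic_wordE]). *)

Lemma induced_iso_of_embedding (G H : sgraph) (S : {set G}) (g : H -> G) :
    injective g -> {mono g : x y / adj x y} -> S =i codom g ->
  sgraph_iso (induced S) H.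
Proof.
move=> g_inj g_adj Sg.
have S_codom (x : induced S) : val x \in codom g by rewrite -Sg (valP x).
have gS y : g y \in S by rewrite Sg codom_f.
have fK : cancel (fun x : induced S => iinv (S_codom x))
                 (fun y => exist _ (g y) (gS y) : induced S).
  by move=> x; apply: val_inj; rewrite /= f_iinv.
exists (fun x => iinv (S_codom x)); last first.
  by move=> x y; rewrite -g_adj !f_iinv.
exists (fun y => exist _ (g y) (gS y)) => // y.
by apply: g_inj; rewrite f_iinv.
Qed.

(** Nonemptiness of the factors is what makes the fibres of [c] pairwise
    distinct and the family of fibres a partition. *)
Lemma decomposes_fibres (G : sgraph) m (Gs : 'I_m -> sgraph) (c : G -> 'I_m) :
    (forall i, 0 < #|Gs i|) ->
    (forall i, sgraph_iso (induced [set x | c x == i]) (Gs i)) ->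
  decomposes G Gs.
Proof.
move=> Gs_gt0 isoV; pose V i := [set x | c x == i].
have V_ex i : exists x, c x = i.
  have [f [g _ _] _] := isoV i; have /card_gt0P[y _] := Gs_gt0 i.
  by have := valP (g y); rewrite inE => /eqP; exists (val (g y)).
exists V; split=> //.
- move=> i j eqV; have [x cx] := V_ex i.
  by have : x \in V j; [rewrite -eqV inE cx | rewrite inE cx => /eqP].
- apply/and3P; split.
  + apply/eqP/setP=> x; rewrite inE; apply/bigcupP.
    by exists (V (c x)); [apply: imset_f | rewrite inE].
  + apply/trivIsetP=> _ _ /imsetP[i _ ->] /imsetP[j _ ->] neqV.
    rewrite -setI_eq0; apply/set0Pn=> -[x].
    rewrite !inE => /andP[/eqP ci /eqP cj].
    by rewrite -ci -cj eqxx in neqV.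
  + apply/imsetP=> -[i _ V0]; have [x cx] := V_ex i.
    by have := in_set0 x; rewrite V0 inE cx eqxx.
Qed.

Section Words.
Variable a : nat.
Hypothesis a_gt0 : 0 < a.
Implicit Types (x y : 'I_a.+1) (s : seq 'I_a.+1).

Definition may_follow : rel 'I_a.+1 :=
  fun x y => (y == ord_max) ==> (x == ord0).

Lemma ord_max_neq0 : ord_max != ord0 :> 'I_a.+1.
Proof. by rewrite -val_eqE /= -lt0n. Qed.

(** Two requirements become one: a virtual letter [a] in front, which is not
    [0], forbids exactly the first letter [a]. *)
Lemma metallic_wordE n (w : n.-tuple 'I_a.+1) :
  metallic_word w = path may_follow ord_max w.
Proof.
apply/forallP/(pathP ord0) => [ok i | ok i].
  rewrite size_tuple => lt_in; apply/implyP => wi_max.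
  have := ok (Ordinal lt_in); rewrite (tnth_nth ord0) wi_max /=.
  case/existsP=> j /andP[/eqP <-]; by rewrite (tnth_nth ord0).
have := ok i; rewrite size_tuple ltn_ord => /(_ isT) /implyP okw.
apply/implyP; rewrite (tnth_nth ord0) => /okw.
case: i {ok okw} => -[|i] lt_in /=; first by rewrite (negPf ord_max_neq0).
move=> w0; apply/existsP; exists (Ordinal (ltnW lt_in)).
by rewrite (tnth_nth ord0) /= eqxx.
Qed.

(** Since [a <> 0], every letter but [a] may follow [a], and these letters may
    follow anything: the context [a] is the most restrictive one. *)
Lemma path_may_follow_max x s :
  path may_follow ord_max s -> path may_follow x s.
Proof.
case: s => //= y s /andP[+ ->]; rewrite andbT /may_follow.
by rewrite (negPf ord_max_neq0) implybF => /negPf ->.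
Qed.

Lemma metallic_cube_gt0 n : 0 < #|metallic_cube a n|.
Proof.
have ok0 : metallic_word [tuple of nseq n (ord0 : 'I_a.+1)].
  rewrite metallic_wordE /=.
  elim: n ord_max => //= n IHn x.
  by rewrite IHn andbT /may_follow eq_sym (negPf ord_max_neq0).
apply/card_gt0P.
by exists (exist _ [tuple of nseq n ord0] ok0 : metallic_cube a n).
Qed.

(** The letters of the common prefix contribute nothing to the distance of two
    words, so prepending [p] preserves adjacency in both directions. *)
Lemma induced_prefix_iso k n (p : k.-tuple 'I_a.+1)
    (S : pred (metallic_cube a (k + n))) :
    (forall s, path may_follow ord_max s -> path may_follow ord_max (p ++ s)) ->
    (forall u : metallic_cube a (k + n),
       reflect (exists2 s, path may_follow ord_max s & val u = p ++ s :> seq _)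
               (S u)) ->
  sgraph_iso (induced [set u | S u]) (metallic_cube a n).
Proof.
move=> p_ok SP.
have g_ok (w : metallic_cube a n) : metallic_word (cat_tuple p (val w)).
  by rewrite metallic_wordE p_ok // -metallic_wordE (valP w).
pose g w : metallic_cube a (k + n) := exist _ (cat_tuple p (val w)) (g_ok w).
apply: (@induced_iso_of_embedding _ (metallic_cube a n) _ g).
- move=> v w /(congr1 (fun u => drop k (val (val u)))) /=.
  by rewrite !drop_size_cat ?size_tuple // => /val_inj/val_inj.
- move=> v w; rewrite /adj /= /metallic_adj big_split_ord /= big1 => [|i _].
    by congr (_ == _); apply: eq_bigr => i _; rewrite !tnth_rshift.
  by rewrite !tnth_lshift distnn.
move=> u; rewrite inE; apply/SP/codomP => [[s s_ok def_u] | [w ->]]; last first.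
  by exists (val w); rewrite // -metallic_wordE (valP w).
have sz_s : size s == n.
  by rewrite -(eqn_add2l k) -{1}(size_tuple p) -size_cat -def_u size_tuple.
have w_ok : metallic_word (Tuple sz_s) by rewrite metallic_wordE.
by exists (exist _ (Tuple sz_s) w_ok : metallic_cube a n); do 2!apply: val_inj.
Qed.

(** In an admissible word a second letter [a] forces the first letter to be
    [0], and the first letter is never [a]; so the value [ord_max] singles out
    the words starting with [0 a]. *)
Definition prefix_class s : 'I_a.+1 :=
  if s is x :: y :: _ then if y == ord_max then ord_max else x else ord_max.

Lemma prefix_class_ltP n (i : 'I_a.+1) (u : metallic_cube a n.+2) : i < a ->
  reflect (exists2 s, path may_follow ord_max s & val u = [:: i] ++ s :> seq _)
          (prefix_class (val u) == i).
Proof.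
move=> lt_ia; have i_max : i == ord_max = false by rewrite -val_eqE ltn_eqF.
have := valP u; rewrite metallic_wordE.
case: (val u) => -[|x [|y s]] //= _ /and3P[_ _ s_ok].
apply: (iffP eqP) => [|[_ /[swap] -[-> <-] /=]].
  case: eqP => [_ /eqP|/eqP y_max ->]; first by rewrite eq_sym i_max.
  by exists (y :: s); rewrite //= s_ok andbT /may_follow (negPf y_max).
by rewrite /may_follow (negPf ord_max_neq0) implybF => /andP[/negPf ->].
Qed.

Lemma prefix_class_maxP n (u : metallic_cube a n.+2) :
  reflect (exists2 s, path may_follow ord_max s
                    & val u = [:: ord0; ord_max] ++ s :> seq _)
          (prefix_class (val u) == ord_max).
Proof.
have := valP u; rewrite metallic_wordE.
case: (val u) => -[|x [|y s]] //= _ /and3P[x_ok y_ok s_ok].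
apply: (iffP eqP) => [|[_ _ [-> -> _]]]; last by rewrite eqxx.
case: eqP => [y_max _ | _ x_max].
  rewrite y_max in y_ok s_ok *; move: y_ok; rewrite /may_follow eqxx /=.
  by move/eqP->; exists s.
by move: x_ok; rewrite /may_follow x_max eqxx (negPf ord_max_neq0).
Qed.

End Words.

Theorem theorem1 (a n : nat) (ha : 1 <= a) (hn : 2 <= n) :
  decomposes (metallic_cube a n)
    (fun i : 'I_a.+1 =>
       if i < a then metallic_cube a (n - 1) else metallic_cube a (n - 2)).
Proof.
case: n hn => [|[|n]] // _; rewrite subn1 subn2 /=.
apply: (@decomposes_fibres _ _ _
          (fun u : metallic_cube a n.+2 => prefix_class (val u))) => i.
  by case: ifP => _; apply: metallic_cube_gt0.
case: ifPn => [lt_ia | ge_ia].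
  apply: (@induced_prefix_iso a ha 1 n.+1 [tuple i]) => [s s_ok | u].
    rewrite /= path_may_follow_max // andbT.
    by rewrite /may_follow -val_eqE /= ltn_eqF.
  exact: prefix_class_ltP.
have -> : i = ord_max.
  by apply: val_inj; apply/eqP; rewrite eqn_leq -ltnS ltn_ord leqNgt.
apply: (@induced_prefix_iso a ha 2 n [tuple ord0; ord_max]) => [s s_ok | u].
  by rewrite /= s_ok /may_follow eq_sym (negPf (ord_max_neq0 ha)) !eqxx.
exact: prefix_class_maxP.
Qed.
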